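(* Let $k\in\mathbb{Z}$. If Goldbach's conjecture is true in the usual arithmetic, then it is true in $\mathcal{Z}_k$ for every even $k$; and it is false in $\mathcal{Z}_k$ for every odd $k$. That is: (i) if $k$ is odd, then $\mathcal{Z}_k$ does not have the $k$-Goldbach property; (ii) if $k$ is even, then $\mathcal{Z}_2$ has the $2$-Goldbach property if and only if $\mathcal{Z}_k$ has the $k$-Goldbach property.
   Context: For $m,n,k\in\mathbb{Z}$ the $k$-arithmetic product is $m\odot_k n=(m-n+1)\cdot n+\frac{n(n-1)k}{2}\in\mathbb{Z}$, where the operations on the right are the usual ones; for $k=2$ it is the usual product $mn$. Write $\mathcal{Z}_k=\{\mathbb{Z},+,\odot_k,<\}$, so that $\mathcal{Z}_2$ is the usual arithmetic. An integer $d>0$ is called a divisor of $a\in\mathbb{Z}$ (arith $k$) if there exists $b\in\mathbb{Z}$ such that $b\odot_k d=a$; divisors are always positive. An integer $p>1$ is called a prime (arith $k$) if it has exactly two divisors (arith $k$). Let $H=\{6,8,10,\ldots\}$ be the set of even integers $\ge 6$. $\mathcal{Z}_k$ has the $k$-Goldbach property if for every $h\in H$ there exist $p_1,p_2$ primes (arith $k$) such that $p_1+p_2=h$. Goldbach's conjecture in the usual arithmetic is the statement that $\mathcal{Z}_2$ has the $2$-Goldbach property, and Goldbach's conjecture in $\mathcal{Z}_k$ is the statement that $\mathcal{Z}_k$ has the $k$-Goldbach property. *)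

(* Defs.v *)
From Stdlib Require Import ZArith Lia.
Open Scope Z_scope.

(* The division by 2 is exact, since n * (n - 1) is even
   (see [arith_prod_halfE]). *)
Definition arith_prod (k m n : Z) : Z :=
  (m - n + 1) * n + (n * (n - 1) * k) / 2.

Definition arith_divisor (k d a : Z) : Prop :=
  0 < d /\ exists b : Z, arith_prod k b d = a.

Definition arith_prime (k p : Z) : Prop :=
  1 < p /\
  exists d1 d2 : Z, d1 <> d2 /\
    forall d : Z, arith_divisor k d p <-> d = d1 \/ d = d2.

Definition goldbach_even (h : Z) : Prop := Z.Even h /\ 6 <= h.

Definition goldbach_property (k : Z) : Prop :=
  forall h : Z, goldbach_even h ->
    exists p1 p2 : Z, arith_prime k p1 /\ arith_prime k p2 /\ p1 + p2 = h.

Lemma arith_prod_halfE (k n : Z) :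
  2 * ((n * (n - 1) * k) / 2) = n * (n - 1) * k.
Proof.
symmetry; apply Z.div_exact; [lia|].
destruct (Z.Even_or_Odd n) as [[q Hq]|[q Hq]]; subst n.
- replace (2 * q * (2 * q - 1) * k) with (q * (2 * q - 1) * k * 2) by ring.
  apply Z.mod_mul; lia.
- replace ((2 * q + 1) * (2 * q + 1 - 1) * k)
    with ((2 * q + 1) * q * k * 2) by ring.
  apply Z.mod_mul; lia.
Qed.

Lemma arith_prod2 (m n : Z) : arith_prod 2 m n = m * n.
Proof. unfold arith_prod; rewrite Z.div_mul by lia; ring. Qed.

(* Main.v *)
(** For even [k], [k]-arithmetic divisibility is ordinary divisibility, so the
    primes do not depend on [k]. For odd [k], an odd [q] divides [r * q], and so
    does [2 * r] because [d (d - 1) k / 2] is congruent to [d / 2] modulo an even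
    [d]; together with [1] this gives three divisors as soon as [q > 1]. Hence
    all primes are powers of 2, and 14 is not a sum of two powers of 2. *)

Require Import Defs.
From Stdlib Require Import ZArith Lia.
Open Scope Z_scope.

(** Doubling removes the division, leaving polynomial identities within reach of [lia]. *)
Lemma arith_prod_double (k m n : Z) :
  2 * arith_prod k m n = 2 * ((m - n + 1) * n) + n * (n - 1) * k.
Proof.
unfold arith_prod; rewrite Z.mul_add_distr_l, arith_prod_halfE; reflexivity.
Qed.

(** The product is [d] times a translate of [b] by an amount depending only on [k] and [d], so the
    cofactor takes every integer value. *)
Lemma arith_divisor_even (k d a : Z) :
  Z.Even k -> arith_divisor k d a <-> 0 < d /\ (d | a).
Proof.
intros [j ->].
assert (E : forall b, arith_prod (2 * j) b d = (b - d + 1 + (d - 1) * j) * d).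
{ intros b; pose proof (arith_prod_double (2 * j) b d); lia. }
split; intros [Hd [b Hb]]; split; trivial.
- exists (b - d + 1 + (d - 1) * j); rewrite <- E; congruence.
- exists (b + d - 1 - (d - 1) * j); rewrite E, Hb; ring.
Qed.

Lemma arith_prime_even (k l p : Z) :
  Z.Even k -> Z.Even l -> arith_prime k p -> arith_prime l p.
Proof.
intros Hk Hl [Hp [d1 [d2 [Hd H]]]]; split; trivial.
exists d1, d2; split; trivial; intros d.
now rewrite <- H, !arith_divisor_even.
Qed.

Lemma goldbach_property_even (k l : Z) :
  Z.Even k -> Z.Even l -> goldbach_property k -> goldbach_property l.
Proof.
intros Hk Hl H h Hh; destruct (H h Hh) as [p1 [p2 [H1 [H2 Hs]]]].
exists p1, p2; eauto using arith_prime_even.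
Qed.

Lemma arith_divisor_1 (k a : Z) : arith_divisor k 1 a.
Proof.
split; [lia|]; exists a; pose proof (arith_prod_double k a 1); lia.
Qed.

Lemma arith_divisor_odd_factor (k r q : Z) :
  0 < q -> Z.Odd q -> arith_divisor k q (r * q).
Proof.
(* With [q = 2 * s + 1], the witness solves [b - 2 * s + s * k = r]. *)
intros Hq [s ->]; split; trivial; exists (r + 2 * s - s * k).
pose proof (arith_prod_double k (r + 2 * s - s * k) (2 * s + 1)); lia.
Qed.

Lemma arith_divisor_double_cofactor (k r q : Z) :
  Z.Odd k -> 0 < r -> Z.Odd q -> arith_divisor k (2 * r) (r * q).
Proof.
(* Cancelling [r] leaves [2 * (b - 2 * r + 1) + (2 * r - 1) * k = q], solvable in [b] because
   [(2 * r - 1) * k] and [q] are both odd. *)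
intros [t ->] Hr [s ->]; split; [lia|]; exists (r + s - 2 * r * t + t).
pose proof (arith_prod_double (2 * t + 1) (r + s - 2 * r * t + t) (2 * r)); lia.
Qed.

Lemma arith_prime_odd_factor (k r q : Z) :
  Z.Odd k -> 0 < r -> 1 < q -> Z.Odd q -> ~ arith_prime k (r * q).
Proof.
intros Hk Hr Hq Oq [_ [d1 [d2 [_ H]]]].
pose proof (proj1 (H _) (arith_divisor_1 k (r * q))).
pose proof (proj1 (H _) (arith_divisor_odd_factor k r q ltac:(lia) Oq)).
pose proof (proj1 (H _) (arith_divisor_double_cofactor k r q Hk Hr Oq)).
(* Parity separates [q] from [2 * r], and both differ from 1. *)
destruct Oq; lia.
Qed.

Lemma arith_prime_lt_14 (k p : Z) :
  Z.Odd k -> arith_prime k p -> p < 14 -> p = 2 \/ p = 4 \/ p = 8.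
Proof.
intros Hk Hp Hlt; pose proof (proj1 Hp).
assert (N : forall r s, 0 < r -> 0 < s -> p <> r * (2 * s + 1)).
{ intros r s Hr Hs ->.
  apply (arith_prime_odd_factor k r (2 * s + 1)); trivial; [lia|now exists s]. }
(* These instances exclude 3, 5, 7, 9, 11, 13, then 6, 10 and 12. *)
pose proof (N 1 1); pose proof (N 1 2); pose proof (N 1 3); pose proof (N 1 4).
pose proof (N 1 5); pose proof (N 1 6); pose proof (N 2 1); pose proof (N 2 2).
pose proof (N 4 1); lia.
Qed.

Theorem theorem4 (k : Z) :
  (Z.Odd k -> ~ goldbach_property k) /\
  (Z.Even k -> (goldbach_property 2 <-> goldbach_property k)).
Proof.
split.
- intros Hk H.
  destruct (H 14) as [p1 [p2 [H1 [H2 Hs]]]]; [split; [now exists 7|lia]|].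
  (* Each summand exceeds 1, so the other is below 14. *)
  pose proof (proj1 H1); pose proof (proj1 H2).
  pose proof (arith_prime_lt_14 k p1 Hk H1).
  pose proof (arith_prime_lt_14 k p2 Hk H2); lia.
- intros Hk; assert (H2 : Z.Even 2) by now exists 1.
  split; apply goldbach_property_even; trivial.
Qed.
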